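(* Let $m_1>m_2>0$ be the translation lengths of two hyperbolic automorphisms $\gamma_1,\gamma_2$ of a locally finite weighted tree, and suppose that $\alpha=m_2/m_1$ is irrational. Define $q_i=\lfloor m_i/m_{i+1}\rfloor$ and $m_{i+2}=m_i-q_im_{i+1}$ for $i\ge1$, and let $$\mathcal L=\{(m_1+m_2)-m_j+qm_{j+1}\mid j\ge1,\ 0\le q\le q_j-1\}.$$ Then the normalized set $$\{1+\alpha-(l/m_1)\mid l\in\mathcal L\}$$ is exactly the set of all gap lengths that occur in the three-gap theorem for the irrational number $\alpha$.
   Context: A weighted tree $(X,w)$ is a tree with a positive real length $w(e)$ assigned to each edge $e$; its automorphisms are the isometries of its metric realization (each edge $e$ replaced by an interval of length $w(e)$), a hyperbolic automorphism is one fixing no point, and its translation length is its (positive) minimum displacement. The elements of $\mathcal L$ are called the exceptional intersection lengths. Three-gap theorem: for an irrational $\alpha$ and a positive integer $N$, the fractional parts $i\alpha-\lfloor i\alpha\rfloor$, $i=1,\dots,N$, partition the circle $\mathbb S^1=[0,1]/(0\sim1)$ (of circumference $1$) into intervals with at most three distinct lengths. The set of all gap lengths occurring in the three-gap theorem for $\alpha$ is the set of all lengths of these intervals as $N$ ranges over all positive integers. *)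

(* Defs.v *)
From mathcomp Require Import all_boot all_order all_algebra.
From mathcomp Require Import all_classical all_reals.

Set Implicit Arguments.
Unset Strict Implicit.
Unset Printing Implicit Defensive.

Import Order.TTheory GRing.Theory Num.Theory.

Local Open Scope classical_set_scope.
Local Open Scope ring_scope.

(* [weight u v] is only meaningful when [adj u v].  In [tree_acyclic] a cycle
   of size 2 is a single edge traversed back and forth. *)
Record weighted_tree (R : realType) := WeightedTree {
  vertex : choiceType;
  adj : rel vertex;
  weight : vertex -> vertex -> R;
  adj_sym : symmetric adj;
  adj_irr : irreflexive adj;
  tree_nonempty : inhabited vertex;
  tree_connected :
    forall u v, exists2 p : seq vertex, path adj u p & last u p = v;
  tree_acyclic : forall c : seq vertex, ucycle adj c -> (size c <= 2)%N;
  weight_sym : forall u v, adj u v -> weight u v = weight v u;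
  weight_gt0 : forall u v, adj u v -> 0 < weight u v }.

Definition locally_finite (R : realType) (X : weighted_tree R) :=
  forall v : vertex X, finite_set [set u : vertex X | adj v u].

Section MetricRealization.
Variables (R : realType) (X : weighted_tree R).

(* Barycentric coordinates of the point dividing the edge [u, v] in the ratio
   t : 1 - t, i.e. lying at distance [t * weight u v] from [u]; for [u = v] it
   is the vertex [u]. *)
Definition edge_point (u v : vertex X) (t : R) : vertex X -> R :=
  fun z => (1 - t) * (z == u)%:R + t * (z == v)%:R.

(* Points are functions on the vertices, so the parametrizations
   ([u], [v], [t]) and ([v], [u], [1 - t]) of an edge point, or the
   parametrizations of a vertex as an end of several edges, give the same
   point.  The case [u = v] is only needed for a one-vertex tree. *)
Definition is_point (x : vertex X -> R) :=
  exists (u v : vertex X) (t : R),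
    [/\ u = v \/ adj u v, 0 <= t <= 1 & x = edge_point u v t].

Definition realization := {x : vertex X -> R | is_point x}.

(* [x] and [y] lie on a common closed edge, at distance [s] along this edge,
   which is identified with an interval of length [weight u v]. *)
Definition segment (x y : realization) (s : R) :=
  exists (u v : vertex X) (a b : R),
    [/\ adj u v, 0 <= a <= 1, 0 <= b <= 1,
        sval x = edge_point u v a /\ sval y = edge_point u v b
      & s = `|a - b| * weight u v].

Inductive chain : realization -> realization -> R -> Prop :=
| chain_nil x : chain x x 0
| chain_cons x y z s l : segment x y s -> chain y z l -> chain x z (s + l).

(* The path metric obtained by gluing the edges. *)
Definition tree_dist (x y : realization) : R := inf [set l | chain x y l].

Definition automorphism (f : realization -> realization) :=
  bijective f /\ forall x y, tree_dist (f x) (f y) = tree_dist x y.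

Definition hyperbolic (f : realization -> realization) :=
  automorphism f /\ forall x, f x <> x.

Definition translation_length (f : realization -> realization) (m : R) :=
  (exists x, tree_dist x (f x) = m) /\ forall x, m <= tree_dist x (f x).

End MetricRealization.

(* Sequences are indexed from 1; the values [m 0] and [q 0] are irrelevant. *)
Definition exceptional_lengths (R : realType) (m : nat -> R) (q : nat -> int)
    : set R :=
  [set l | exists (j : nat) (k : int),
    [/\ (1 <= j)%N, 0 <= k <= q j - 1
      & l = (m 1%N + m 2%N) - m j + k%:~R * m j.+1]].

Section ThreeGap.
Variable R : realType.

Definition frac_part (x : R) : R := x - (Num.floor x)%:~R.

Definition rotation_points (alpha : R) (N : nat) : set R :=
  [set frac_part (i%:R * alpha) | i in [set i : nat | (1 <= i <= N)%N]].

(* Arcs of the circle [0, 1] / (0 ~ 1), represented by [0, 1[, traversed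
   in the positive direction from [a] to [b]; for [a = b] the arc makes one full
   turn. *)
Definition open_arc (a b : R) : set R :=
  [set x | 0 <= x < 1 /\ (if a < b then a < x < b else (a < x) || (x < b))].

Definition arc_length (a b : R) : R := if a < b then b - a else 1 - a + b.

Definition gap_lengths (alpha : R) (N : nat) : set R :=
  [set l | exists a b : R,
    [/\ rotation_points alpha N a, rotation_points alpha N b,
        rotation_points alpha N `&` open_arc a b = set0
      & l = arc_length a b]].

Definition all_gap_lengths (alpha : R) : set R :=
  [set l | exists2 N : nat, (0 < N)%N & gap_lengths alpha N l].

End ThreeGap.

(* Main.v *)
Require Import Defs.
From mathcomp Require Import all_boot all_order all_algebra.
From mathcomp Require Import all_classical all_reals.
From mathcomp Require Import ring lra zify.

Set Implicit Arguments.
Unset Strict Implicit.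
Unset Printing Implicit Defensive.

Import Order.TTheory GRing.Theory Num.Theory.

Local Open Scope classical_set_scope.
Local Open Scope ring_scope.

(** After division by [m 1], the theorem says that the gap lengths of the
    rotation by alpha are the numbers [e j - k e (j+1)] with
    [0 <= k < q j], where [e j = m j / m 1] are the remainders of the Euclidean
    algorithm on 1 and alpha.  Both sets are compared with the
    Stern-Brocot intervals [u/p < alpha < v/r], obtained from [0/1 < alpha < 1/1]
    by repeatedly inserting the mediant [(u+v)/(p+r)].  Such an interval has
    two lengths, [a = p alpha - u] and [b = v - r alpha], and inserting the
    mediant replaces the larger one by the difference of the two.

    On the side of the rotation, [v p - u r = 1], so every integer vector
    [(k, z)] is an integral combination of [(p, u)] and [(r, v)].  Hence for
    [`|k| < p + r] the only values of [k alpha - z] strictly between 0 and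
    [a + b] are multiples of [a] and of [b] ([farey_small_displacement]).  If
    [max(p, r) < N <= p + r], the successor on the circle of the point of index
    [i] therefore has index [i + p], [i - r] or [i + p - r], so all gaps have
    length [a], [b] or [a + b] ([farey_gap]); for [N = p + r] both [a] and [b]
    occur ([farey_gap_left], [farey_gap_right]).  Every [N >= 2] is of this kind
    for some interval, and [a + b] is 1 or a length of the preceding interval.
    So the gap lengths are 1 and the lengths of the Stern-Brocot intervals
    ([all_gap_lengthsE]).

    On the side of the Euclidean algorithm, the passage from [{a, b}] to
    [{a - b, b}] is one subtraction step, so the pairs [{a, b}] are exactly the
    pairs [{e j - (k + 1) e (j+1), e (j+1)}] with [0 <= k < q j]
    ([farey_pair_euclid_sub], [farey_interval_euclid]).  The positivity of the
    remainders is inherited from that of [a] and [b]. *)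

(** * Gaps of a rotation as minimal arcs *)

Section Rotation.
Variables (R : realType) (alpha : R).

(** The real number [k alpha - z], a lift to the line of the rotation by
    [k alpha] on the circle. *)
Definition displacement (k z : int) : R := k%:~R * alpha - z%:~R.

Lemma displacementD (k z k' z' : int) :
  displacement (k + k') (z + z') = displacement k z + displacement k' z'.
Proof. by rewrite /displacement !intrD; ring. Qed.

Lemma displacementN (k z : int) : displacement (- k) (- z) = - displacement k z.
Proof. by rewrite /displacement !mulrNz; ring. Qed.

Lemma irrational_displacement_neq0 (k z : int) :
  irrational alpha -> k != 0 -> displacement k z != 0.
Proof.
move=> irr k0; apply/eqP => /subr0_eq E; apply: irr.
exists (z%:~R / k%:~R) => //.
have kR : k%:~R != 0 :> R by rewrite intr_eq0.
by rewrite rmorphM /= fmorphV !ratr_int -E; field.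
Qed.

(** Length of the arc from the point of index [i] to the point of index [j] in
    the positive direction; it is 1 when the two points coincide. *)
Definition dist_to (i j : nat) : R :=
  arc_length (frac_part (i%:R * alpha)) (frac_part (j%:R * alpha)).

Lemma frac_part_itv (x : R) : 0 <= frac_part x < 1.
Proof.
have := floor_itv x; rewrite intrD /frac_part => /andP[h1 h2].
by apply/andP; split; lra.
Qed.

Lemma arc_length_itv (a b : R) :
  0 <= a < 1 -> 0 <= b < 1 -> 0 < arc_length a b <= 1.
Proof.
rewrite /arc_length => /andP[a0 a1] /andP[b0 b1].
by case: (ltP a b) => ab; apply/andP; split; lra.
Qed.

(** The convention that the arc from a point to itself is a full turn makes
    this equivalence valid also when [a = b], [a = c] or [b = c]. *)
Lemma open_arcE (a b c : R) : 0 <= a < 1 -> 0 <= b < 1 -> 0 <= c < 1 ->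
  open_arc a b c <-> arc_length a c < arc_length a b.
Proof.
rewrite /open_arc /arc_length /= => /andP[a0 a1] /andP[b0 b1] /andP[c0 c1].
split.
  by case=> _; case: (ltP a b) => ab; [case/andP|case/orP]; case: (ltP a c); lra.
by case: (ltP a b) => ab; case: (ltP a c) => ac h; split;
  rewrite ?c0 ?c1 //=; lra.
Qed.

Lemma dist_to_itv i j : 0 < dist_to i j <= 1.
Proof. by apply: arc_length_itv; apply: frac_part_itv. Qed.

Lemma dist_to_displacement (i j : nat) :
  exists z : int, dist_to i j = displacement (j%:Z - i%:Z) z.
Proof.
rewrite /dist_to /arc_length /displacement intrB -!pmulrn /frac_part.
set fi := Num.floor (i%:R * alpha); set fj := Num.floor (j%:R * alpha).
case: ifP => _; [exists (fj - fi)|exists (fj - fi - 1)]; rewrite !intrB; ring.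
Qed.

(** The representative of a rotation in the interval from 0 (excluded) to 1
    (included) is unique. *)
Lemma dist_toE (i j : nat) (z : int) :
  0 < displacement (j%:Z - i%:Z) z <= 1 ->
  dist_to i j = displacement (j%:Z - i%:Z) z.
Proof.
have [z' E] := dist_to_displacement i j; have := dist_to_itv i j.
rewrite E /displacement => /andP[h1 h2] /andP[h3 h4].
have : (z' < z + 1)%R by rewrite -(ltr_int R) intrD; lra.
have : (z < z' + 1)%R by rewrite -(ltr_int R) intrD; lra.
by move=> ? ?; congr (_ - _%:~R); lia.
Qed.

Lemma gap_lengthsP (N : nat) (x : R) : gap_lengths alpha N x <->
  exists i j : nat, [/\ (1 <= i <= N)%N, (1 <= j <= N)%N, x = dist_to i j &
    forall l : nat, (1 <= l <= N)%N -> dist_to i j <= dist_to i l].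
Proof.
split.
  move=> [_ [_ [[i iN <-] [j jN <-] E0 ->]]]; exists i, j; split=> // l lN.
  rewrite leNgt; apply/negP => lt.
  suff : set0 (frac_part (l%:R * alpha)) by [].
  rewrite -E0; split; first by exists l.
  by apply/open_arcE => //; apply: frac_part_itv.
move=> [i [j [iN jN -> jmin]]].
exists (frac_part (i%:R * alpha)), (frac_part (j%:R * alpha)).
split=> //; [by exists i|by exists j|].
rewrite -subset0 => _ [[l lN <-]] /open_arcE.
move=> /(_ (frac_part_itv _) (frac_part_itv _) (frac_part_itv _)).
by rewrite ltNge; apply/negP; rewrite negbK; exact: jmin.
Qed.

(** * Stern-Brocot intervals and the gaps they produce *)

(** [farey_interval p u r v]: the fractions [u/p < v/r] bound one of the
    intervals around alpha met in the descent of the Stern-Brocot tree from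
    [0/1, 1/1].  The sign of the displacement of the mediant tells on which side
    of alpha it lies: [farey_raise] makes it the new lower endpoint,
    [farey_lower] the new upper endpoint. *)
Inductive farey_interval : int -> int -> int -> int -> Prop :=
| farey_root : farey_interval 1 0 1 1
| farey_raise p u r v : farey_interval p u r v ->
    0 < displacement (p + r) (u + v) -> farey_interval (p + r) (u + v) r v
| farey_lower p u r v : farey_interval p u r v ->
    displacement (p + r) (u + v) < 0 -> farey_interval p u (p + r) (u + v).

Hypothesis alpha_itv : 0 < alpha < 1.

Lemma farey_interval_inv p u r v : farey_interval p u r v ->
  [/\ 1 <= p, 1 <= r, v * p - u * r = 1 &
    [/\ 0 < displacement p u, displacement r v < 0 &
        displacement p u - displacement r v <= 1]].
Proof.
elim=> {p u r v} [|p u r v _ [p1 r1 d [a0 b0 ab]] h|p u r v _ [p1 r1 d [a0 b0 ab]] h].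
- by rewrite /displacement; case/andP: alpha_itv => ? ?; split=> //; split; lra.
- by rewrite displacementD in h *; split; [lia|lia|nia|split; lra].
- by rewrite displacementD in h *; split; [lia|lia|nia|split; lra].
Qed.

(** Up to the index [p + r], the displacements smaller than the sum of the two
    lengths of the interval are multiples of one of these lengths:
    unimodularity gives integral coordinates [s], [t] of [(k, z)] in the basis
    [(p, u)], [(r, v)], and unless one of them vanishes, their signs make the
    index or the displacement too large, or the displacement negative. *)
Lemma farey_small_displacement p u r v (k z : int) : farey_interval p u r v ->
  `|k| < p + r ->
  0 < displacement k z < displacement p u - displacement r v ->
  (exists2 s : int, 1 <= s & k = s * p /\ displacement k z = s%:~R * displacement p u)
  \/ (exists2 s : int, 1 <= s &
       k = - (s * r) /\ displacement k z = - (s%:~R * displacement r v)).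
Proof.
move=> /farey_interval_inv [p1 r1 d [a0 b0 ab]] kpr /andP[x0 x1].
pose s := k * v - z * r; pose t := z * p - k * u.
have kE : k = s * p + t * r.
  by transitivity (k * (v * p - u * r)); [rewrite d mulr1|rewrite /s /t; ring].
have zE : z = s * u + t * v.
  by transitivity (z * (v * p - u * r)); [rewrite d mulr1|rewrite /s /t; ring].
move: s t kE zE => s t kE zE.
have xE : displacement k z = s%:~R * displacement p u + t%:~R * displacement r v.
  by rewrite kE zE /displacement !intrD !intrM; ring.
rewrite xE in x0 x1.
have [s1|s0] := leP 1 s; have [t1|t0] := leP 1 t.
- by exfalso; nia.
- have [t_0|tn0] := eqVneq t 0.
    left; exists s => //; split; first by rewrite kE t_0 mul0r addr0.
    by rewrite xE t_0 mul0r addr0.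
  have sR : 1 <= s%:~R :> R by rewrite -[1]/(1%:~R) ler_int.
  have tR : t%:~R <= -1 :> R by rewrite -[-1]/((-1)%:~R) ler_int; lia.
  have := ler_wpM2r (ltW a0) sR; have := ler_wnM2r (ltW b0) tR.
  by move: x1; rewrite mul1r mulN1r; lra.
- have sR : s%:~R <= 0 :> R by rewrite -[0]/(0%:~R) ler_int; lia.
  have tR : 0 <= t%:~R :> R by rewrite -[0]/(0%:~R) ler_int; lia.
  have := mulr_le0_ge0 sR (ltW a0); have := mulr_ge0_le0 tR (ltW b0).
  by move: x0; lra.
- have [s_0|sn0] := eqVneq s 0.
    right; exists (- t).
      have : t%:~R < 0 :> R.
        by move: x0; rewrite s_0 mul0r add0r; nra.
      by rewrite -[0]/(0%:~R) ltr_int; lia.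
    by rewrite xE kE s_0 !mul0r !add0r mulrNz; split; ring.
  have [t_0|tn0] := eqVneq t 0.
    have : s%:~R <= 0 :> R by rewrite -[0]/(0%:~R) ler_int; lia.
    by move: x0; rewrite t_0; nra.
  by exfalso; nia.
Qed.

(** The upper bound in the three-gap theorem. *)
Lemma farey_gap p u r v (N : nat) x : farey_interval p u r v ->
  p < N%:Z -> r < N%:Z -> N%:Z <= p + r -> gap_lengths alpha N x ->
  [\/ x = displacement p u, x = - displacement r v |
      x = displacement p u - displacement r v].
Proof.
move=> F pN rN Npr /gap_lengthsP [i [j [iN jN -> jmin]]].
have [p1 r1 d [a0 b0 ab]] := farey_interval_inv F.
have dist_le (k z : int) : 0 < displacement k z <= 1 ->
    1 <= i%:Z + k <= N%:Z -> dist_to i j <= displacement k z.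
  move=> kz ikN.
  have kE : k = (absz (i%:Z + k))%:Z - i%:Z by lia.
  by rewrite kE in kz *; rewrite -(dist_toE kz); apply: jmin; lia.
have le_a : i%:Z + p <= N%:Z -> dist_to i j <= displacement p u.
  by move=> ?; apply: dist_le; [apply/andP; split; lra|lia].
have le_b : 1 <= i%:Z - r -> dist_to i j <= - displacement r v.
  move=> ?; rewrite -displacementN; apply: dist_le; last lia.
  by rewrite displacementN; apply/andP; split; lra.
have le_ab : dist_to i j <= displacement p u - displacement r v.
  have [ipN|ipN] := leP (i%:Z + p) N%:Z.
    by have := le_a ipN; lra.
  have [ir|ir] := leP 1 (i%:Z - r); first by have := le_b ir; lra.
  (* Here [N - p < i <= r], so the point of index [i + p - r] exists. *)
  rewrite -displacementN -displacementD; apply: dist_le; last lia.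
  by rewrite displacementD displacementN; apply/andP; split; lra.
move: le_ab; rewrite le_eqVlt => /orP[/eqP ->|lt_ab]; first by constructor 3.
have [z zE] := dist_to_displacement i j.
have /andP[x0 _] := dist_to_itv i j; rewrite zE in x0 lt_ab le_a le_b *.
have ijpr : `|j%:Z - i%:Z| < p + r by lia.
have xab : 0 < displacement (j%:Z - i%:Z) z < displacement p u - displacement r v.
  by rewrite x0.
have [[s s1 [ks xs]]|[s s1 [ks xs]]] := farey_small_displacement F ijpr xab.
(* Since [j = i + s p <= N] with [s >= 1], the point of index [i + p] exists,
   and minimality forces the displacement to be [p alpha - u]; the other case is
   symmetric. *)
- constructor 1; apply/eqP; rewrite eq_le le_a /=; last nia.
  by rewrite xs ler_peMl ?ler1z // ltW.
- constructor 2; apply/eqP; rewrite eq_le le_b /=; last nia.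
  by rewrite xs -mulrN ler_peMl ?ler1z // oppr_ge0 ltW.
Qed.

(** The gap following the point of index 1 has length [p alpha - u]. *)
Lemma farey_gap_left p u r v : farey_interval p u r v ->
  gap_lengths alpha (absz (p + r)) (displacement p u).
Proof.
move=> F; have [p1 r1 d [a0 b0 ab]] := farey_interval_inv F.
apply/gap_lengthsP; exists 1%N, (absz (p + 1)).
have pE : p = (absz (p + 1))%:Z - 1%N%:Z by lia.
have aE : dist_to 1 (absz (p + 1)) = displacement p u.
  by rewrite {2}pE; apply: dist_toE; rewrite -pE; apply/andP; split; lra.
split; [lia|lia|by rewrite aE|move=> l lN].
rewrite leNgt; apply/negP; rewrite aE => lt.
have [z zE] := dist_to_displacement 1 l.
have /andP[x0 _] := dist_to_itv 1 l; rewrite zE in lt x0.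
have lpr : `|l%:Z - 1%N%:Z| < p + r by lia.
have [|[s s1 [ks xs]]|[s s1 [ks xs]]] := farey_small_displacement F lpr (z := z).
- by apply/andP; split; lra.
- by move: lt; rewrite xs ltNge ler_peMl ?ler1z // ltW.
- by nia.
Qed.

(** The gap following the point of index [r + 1] has length [v - r alpha]. *)
Lemma farey_gap_right p u r v : farey_interval p u r v ->
  gap_lengths alpha (absz (p + r)) (- displacement r v).
Proof.
move=> F; have [p1 r1 d [a0 b0 ab]] := farey_interval_inv F.
apply/gap_lengthsP; exists (absz (r + 1)), 1%N.
have rE : - r = 1%N%:Z - (absz (r + 1))%:Z by lia.
have bE : dist_to (absz (r + 1)) 1 = - displacement r v.
  rewrite -displacementN rE; apply: dist_toE.
  by rewrite -rE displacementN; apply/andP; split; lra.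
split; [lia|lia|by rewrite bE|move=> l lN].
rewrite leNgt; apply/negP; rewrite bE => lt.
have [z zE] := dist_to_displacement (absz (r + 1)) l.
have /andP[x0 _] := dist_to_itv (absz (r + 1)) l; rewrite zE in lt x0.
have lpr : `|l%:Z - (absz (r + 1))%:Z| < p + r by lia.
have [|[s s1 [ks xs]]|[s s1 [ks xs]]] := farey_small_displacement F lpr (z := z).
- by apply/andP; split; lra.
- by nia.
- move: lt; rewrite xs -mulrN ltNge ler_peMl ?ler1z //.
  by rewrite oppr_ge0 ltW.
Qed.

(** The displacements, up to sign, of the endpoints of the Stern-Brocot
    intervals. *)
Definition farey_length (x : R) := exists p u r v : int,
  farey_interval p u r v /\ (x = displacement p u \/ x = - displacement r v).

(** The sum of the two lengths is a length of the interval from which this one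
    was obtained by inserting the mediant. *)
Lemma farey_sum p u r v : farey_interval p u r v ->
  displacement p u - displacement r v = 1 \/
  farey_length (displacement p u - displacement r v).
Proof.
case=> {p u r v} [|p u r v F _|p u r v F _].
- by left; rewrite /displacement; ring.
- by right; exists p, u, r, v; split=> //; left; rewrite displacementD addrK.
- right; exists p, u, r, v; split=> //; right.
  by rewrite displacementD; ring.
Qed.

Hypothesis alpha_irr : irrational alpha.

Lemma farey_mediant_neq0 p u r v : farey_interval p u r v ->
  displacement (p + r) (u + v) != 0.
Proof.
move=> /farey_interval_inv [p1 r1 _ _].
by apply: irrational_displacement_neq0 => //; lia.
Qed.

Lemma farey_interval_at (N : nat) : (2 <= N)%N -> exists p u r v : int,
  [/\ farey_interval p u r v, p < N%:Z, r < N%:Z & N%:Z <= p + r].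
Proof.
elim: N => // N IH; rewrite leq_eqVlt => /orP[/eqP <-|N2].
  by exists 1, 0, 1, 1; split=> //; exact: farey_root.
have [p [u [r [v [F pN rN Npr]]]]] := IH N2.
have [lt|ge] := ltP N%:Z (p + r).
  by exists p, u, r, v; split=> //; lia.
have [p1 r1 _ _] := farey_interval_inv F.
have := farey_mediant_neq0 F; rewrite neq_lt => /orP[h|h].
- by exists p, u, (p + r), (u + v); split; [exact: farey_lower|lia|lia|lia].
- by exists (p + r), (u + v), r, v; split; [exact: farey_raise|lia|lia|lia].
Qed.

Lemma all_gap_lengthsE (x : R) :
  all_gap_lengths alpha x <-> x = 1 \/ farey_length x.
Proof.
split.
  move=> [N N0 G]; have [N2|N1] := leqP 2 N.
    have [p [u [r [v [F pN rN Npr]]]]] := farey_interval_at N2.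
    case: (farey_gap F pN rN Npr G) => ->; last exact: farey_sum.
    - by right; exists p, u, r, v; split=> //; left.
    - by right; exists p, u, r, v; split=> //; right.
  have -> // : x = 1; last by left.
  move/gap_lengthsP: G => [i [j [iN jN -> _]]].
  have [-> ->] : i = 1%N /\ j = 1%N by lia.
  by rewrite /dist_to /arc_length ltxx subrK.
case=> [->|[p [u [r [v [F E]]]]]].
  exists 1%N => //; apply/gap_lengthsP; exists 1%N, 1%N.
  have E1 : dist_to 1 1 = 1 by rewrite /dist_to /arc_length ltxx subrK.
  split=> // l lN.
  by have -> : l = 1%N by lia.
have [p1 r1 _ _] := farey_interval_inv F.
exists (absz (p + r)); first by lia.
by case: E => ->; [exact: (farey_gap_left F)|exact: (farey_gap_right F)].
Qed.

End Rotation.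

(** * Stern-Brocot intervals and the Euclidean algorithm *)

Section Euclid.
Variables (R : realType) (alpha : R) (e : nat -> R) (q : nat -> int).
Hypotheses (alpha_itv : 0 < alpha < 1) (alpha_irr : irrational alpha).
Hypotheses (e1 : e 1%N = 1) (e2 : e 2%N = alpha).
Hypothesis qE : forall i, (1 <= i)%N -> q i = Num.floor (e i / e i.+1).
Hypothesis eE : forall i, (1 <= i)%N -> e i.+2 = e i - (q i)%:~R * e i.+1.

(** [x] and [y] are, in some order, the two lengths of a Stern-Brocot interval. *)
Definition farey_pair (x y : R) := exists p u r v : int,
  farey_interval alpha p u r v /\
  ((x = displacement alpha p u /\ y = - displacement alpha r v) \/
   (x = - displacement alpha r v /\ y = displacement alpha p u)).

Lemma farey_pairC x y : farey_pair x y -> farey_pair y x.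
Proof.
move=> [p [u [r [v [F [[-> ->]|[-> ->]]]]]]]; exists p, u, r, v; split=> //.
- by right.
- by left.
Qed.

Lemma farey_pair_gt0 x y : farey_pair x y -> 0 < x /\ 0 < y.
Proof.
move=> [p [u [r [v [F]]]]].
have [_ _ _ [a0 b0 _]] := farey_interval_inv alpha_itv F.
by case=> -[-> ->]; split; lra.
Qed.

Lemma farey_pair_neq x y : farey_pair x y -> x != y.
Proof.
move=> [p [u [r [v [F]]]]].
have := farey_mediant_neq0 alpha_itv alpha_irr F.
rewrite displacementD => n0.
by case=> -[-> ->]; apply: contra n0 => /eqP; lra.
Qed.

Lemma farey_pair_sub x y : farey_pair x y -> y < x -> farey_pair (x - y) y.
Proof.
move=> [p [u [r [v [F [[-> ->]|[-> ->]]]]]]] lt.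
- have h : 0 < displacement alpha (p + r) (u + v) by rewrite displacementD; lra.
  exists (p + r), (u + v), r, v; split; first exact: farey_raise.
  by left; rewrite displacementD opprK.
- have h : displacement alpha (p + r) (u + v) < 0 by rewrite displacementD; lra.
  exists p, u, (p + r), (u + v); split; first exact: farey_lower.
  by right; split=> //; rewrite displacementD; ring.
Qed.

Lemma quotient_bounds j : (1 <= j)%N -> 0 < e j.+1 ->
  (q j)%:~R * e j.+1 <= e j < ((q j)%:~R + 1) * e j.+1.
Proof.
move=> j1 e0; have := floor_itv (e j / e j.+1).
by rewrite -(qE j1) intrD ler_pdivlMr // ltr_pdivrMr.
Qed.

Lemma quotient_ge1_of_le j :
  (1 <= j)%N -> 0 < e j.+1 -> e j.+1 <= e j -> 1 <= q j.
Proof.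
move=> j1 e0 le; suff : 0 < q j by lia.
by rewrite (qE j1) floor_gt0 ler_pdivlMr // mul1r.
Qed.

Lemma farey_pair_euclid_sub j (k : nat) : (1 <= j)%N ->
  farey_pair (e j - e j.+1) (e j.+1) -> k%:Z < q j ->
  farey_pair (e j - (k%:R + 1) * e j.+1) (e j.+1).
Proof.
move=> j1 F0; elim: k => [_|k IH kq]; first by rewrite add0r mul1r.
have /IH F : k%:Z < q j by lia.
have [_ e0] := farey_pair_gt0 F; have neq := farey_pair_neq F.
have -> : e j - (k.+1%:R + 1) * e j.+1 = e j - (k%:R + 1) * e j.+1 - e j.+1.
  by rewrite -(addn1 k) natrD; ring.
apply: farey_pair_sub => //; rewrite lt_neqAle eq_sym neq /=.
have /andP[h _] := quotient_bounds j1 e0.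
have : (k%:R + 2 : R) <= (q j)%:~R.
  have : k%:Z + 2 <= q j by lia.
  by rewrite -(ler_int R) intrD -pmulrn.
by nra.
Qed.

(** For each [j], the pairs of [farey_pair_euclid_sub] start with this one; the
    last of them is [{e j.+2, e j.+1}], whose subtraction step starts the pairs
    of [j.+1]. *)
Lemma farey_pair_euclid_diff j :
  (1 <= j)%N -> farey_pair (e j - e j.+1) (e j.+1).
Proof.
elim: j => // -[_ _|j IH _].
  rewrite e1 e2; exists 1, 0, 1, 1; split; first exact: farey_root.
  by right; rewrite /displacement; split; ring.
have F := IH isT; have [h0 e0] := farey_pair_gt0 F.
have /andP[h1 h2] := quotient_bounds (ltn0Sn j) e0.
have q1 : 1 <= q j.+1 by apply: quotient_ge1_of_le => //; lra.
have lt : (absz (q j.+1 - 1))%:Z < q j.+1 by lia.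
have := farey_pair_euclid_sub (ltn0Sn j) F lt.
have -> : ((absz (q j.+1 - 1))%:R + 1 : R) = (q j.+1)%:~R.
  have {2}<- : (absz (q j.+1 - 1))%:Z + 1 = q j.+1 by lia.
  by rewrite intrD -pmulrn.
rewrite -(eE (ltn0Sn j)) => /farey_pairC G; apply: farey_pair_sub => //.
by rewrite (eE (ltn0Sn j)); nra.
Qed.

Lemma euclid_gt0 j : (1 <= j)%N -> 0 < e j.+1.
Proof. by move=> /farey_pair_euclid_diff /farey_pair_gt0 []. Qed.

Lemma quotient_ge1 j : (1 <= j)%N -> 1 <= q j.
Proof.
move=> j1; have [h0 e0] := farey_pair_gt0 (farey_pair_euclid_diff j1).
by apply: quotient_ge1_of_le => //; lra.
Qed.

(** [x] and [y] are, in some order, a pair met in the subtractive Euclidean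
    algorithm: [e j.+1] and what remains of [e j] after [k + 1] of the [q j]
    subtractions. *)
Definition euclid_pair (x y : R) := exists (j : nat) (k : int),
  [/\ (1 <= j)%N, 0 <= k < q j &
    (x = e j - (k%:~R + 1) * e j.+1 /\ y = e j.+1) \/
    (x = e j.+1 /\ y = e j - (k%:~R + 1) * e j.+1)].

Lemma euclid_pairC x y : euclid_pair x y -> euclid_pair y x.
Proof.
by move=> [j [k [j1 kq [[-> ->]|[-> ->]]]]]; exists j, k; split=> //;
  [right|left].
Qed.

Lemma euclid_pair_sub x y : euclid_pair x y -> y < x -> euclid_pair (x - y) y.
Proof.
move=> [j [k [j1 kq E]]] lt; have e0 := euclid_gt0 j1.
have /andP[h1 h2] := quotient_bounds j1 e0.
have [kq1|kq1] := ltP (k + 1) (q j).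
  have : (k%:~R + 2 : R) <= (q j)%:~R.
    have : k + 2 <= q j by lia.
    by rewrite -(ler_int R) intrD.
  move=> kR; have := ler_wpM2r (ltW e0) kR.
  case: E => [[xE yE]|[xE yE]] h; last by move: lt; rewrite xE yE; lra.
  exists j, (k + 1); split=> //; first by lia.
  by left; split=> //; rewrite xE yE intrD; ring.
have kE : (q j)%:~R = k%:~R + 1 :> R.
  have -> : q j = k + 1 by lia.
  by rewrite intrD.
have e3 : e j.+2 = e j - (k%:~R + 1) * e j.+1 by rewrite (eE j1) kE.
case: E => [[xE yE]|[xE yE]]; first by move: lt h2; rewrite xE yE kE; lra.
exists j.+1, 0; split=> //; first by have := quotient_ge1 (ltn0Sn j); lia.
by left; rewrite xE yE e3; split=> //; ring.
Qed.

Lemma farey_interval_euclid p u r v : farey_interval alpha p u r v ->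
  euclid_pair (displacement alpha p u) (- displacement alpha r v).
Proof.
elim=> {p u r v} [|p u r v _ IH h|p u r v _ IH h].
- exists 1%N, 0; split=> //; first by have := @quotient_ge1 1 isT; lia.
  by right; rewrite /displacement e1 e2; split; ring.
- have -> : displacement alpha (p + r) (u + v) =
    displacement alpha p u - - displacement alpha r v.
    by rewrite displacementD opprK.
  by apply: euclid_pair_sub => //; rewrite displacementD in h; lra.
- have -> : - displacement alpha (p + r) (u + v) =
    - displacement alpha r v - displacement alpha p u.
    by rewrite displacementD; ring.
  apply: euclid_pairC; apply: euclid_pair_sub; first exact: euclid_pairC.
  by rewrite displacementD in h; lra.
Qed.

(** The normalized set of exceptional lengths; the number 1 is the case [j = 1],
    [k = 0]. *)
Definition euclid_length (x : R) := exists (j : nat) (k : int),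
  [/\ (1 <= j)%N, 0 <= k <= q j - 1 & x = e j - k%:~R * e j.+1].

Lemma euclid_remainder_length j : (1 <= j)%N -> euclid_length (e j).
Proof.
move=> j1; exists j, 0; split=> //; first by have := quotient_ge1 j1; lia.
by rewrite mul0r subr0.
Qed.

Lemma euclid_pair_length x y :
  euclid_pair x y -> euclid_length x /\ euclid_length y.
Proof.
move=> [j [k [j1 kq E]]].
have E1 : euclid_length (e j.+1) by exact: euclid_remainder_length.
suff E2 : euclid_length (e j - (k%:~R + 1) * e j.+1).
  by case: E => -[-> ->].
have [kq1|kq1] := ltP (k + 1) (q j).
  by exists j, (k + 1); split=> //; [lia|rewrite intrD].
have kE : q j = k + 1 by lia.
have -> : k%:~R + 1 = (q j)%:~R :> R by rewrite kE intrD.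
by rewrite -(eE j1); exact: euclid_remainder_length.
Qed.

Lemma euclid_lengthP (x : R) :
  euclid_length x <-> x = 1 \/ farey_length alpha x.
Proof.
have farey_pair_length y z : farey_pair y z -> farey_length alpha y.
  move=> [p [u [r [v [F [[-> _]|[-> _]]]]]]]; exists p, u, r, v; split=> //.
  - by left.
  - by right.
split.
  move=> [j [k [j1 kq ->]]]; have F := farey_pair_euclid_diff j1.
  have [k1|k0] := leP 1 k.
    right; have lt : (absz (k - 1))%:Z < q j by lia.
    have := farey_pair_euclid_sub j1 F lt.
    have -> : ((absz (k - 1))%:R + 1 : R) = k%:~R.
      have {2}<- : (absz (k - 1))%:Z + 1 = k by lia.
      by rewrite intrD -pmulrn.
    exact: farey_pair_length.
  have -> : k = 0 by lia.
  rewrite mul0r subr0; case: j j1 {F kq} => // -[_|j _]; first by left.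
  right; apply: farey_pair_length.
  exact: farey_pairC (farey_pair_euclid_diff (ltn0Sn j)).
case=> [->|[p [u [r [v [F E]]]]]].
  by rewrite -e1; exact: euclid_remainder_length.
have [La Lb] := euclid_pair_length (farey_interval_euclid F).
by case: E => ->.
Qed.

End Euclid.

Theorem corollary4p20 (R : realType) (X : weighted_tree R)
    (X_lf : locally_finite X)
    (gamma1 gamma2 : realization X -> realization X)
    (hyp1 : hyperbolic gamma1) (hyp2 : hyperbolic gamma2)
    (m : nat -> R) (q : nat -> int) (alpha : R)
    (len1 : translation_length gamma1 (m 1%N))
    (len2 : translation_length gamma2 (m 2%N))
    (m2_gt0 : 0 < m 2%N) (m2_lt_m1 : m 2%N < m 1%N)
    (alphaE : alpha = m 2%N / m 1%N) (alpha_irr : irrational alpha)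
    (qE : forall i : nat, (1 <= i)%N -> q i = Num.floor (m i / m i.+1))
    (mE : forall i : nat, (1 <= i)%N -> m i.+2 = m i - (q i)%:~R * m i.+1) :
  [set 1 + alpha - l / m 1%N | l in exceptional_lengths m q]
  = all_gap_lengths alpha.
Proof.
have m1_gt0 : 0 < m 1%N by apply: lt_trans m2_lt_m1.
have m1_neq0 : m 1%N != 0 by rewrite gt_eqF.
have alpha_itv : 0 < alpha < 1.
  by rewrite alphaE divr_gt0 // ltr_pdivrMr // mul1r.
pose e j := m j / m 1%N.
have e1 : e 1%N = 1 by rewrite /e divff.
have e2 : e 2%N = alpha by rewrite alphaE.
have eqE i : (1 <= i)%N -> q i = Num.floor (e i / e i.+1).
  by move=> i1; rewrite (qE _ i1) /e invf_div mulrA divfK.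
have eE i : (1 <= i)%N -> e i.+2 = e i - (q i)%:~R * e i.+1.
  by move=> i1; rewrite /e (mE _ i1) mulrBl mulrA.
have normalizedE j (k : int) :
    1 + alpha - (m 1%N + m 2%N - m j + k%:~R * m j.+1) / m 1%N
    = e j - k%:~R * e j.+1.
  by rewrite alphaE /e; field.
have lengthP := euclid_lengthP alpha_itv alpha_irr e1 e2 eqE eE.
apply/seteqP; split=> x.
  move=> [_ [j [k [j1 kq ->]]] <-]; apply/(all_gap_lengthsE alpha_itv alpha_irr).
  by apply/lengthP; exists j, k; split=> //; exact: normalizedE.
move=> /(all_gap_lengthsE alpha_itv alpha_irr) /lengthP [j [k [j1 kq ->]]].
by exists (m 1%N + m 2%N - m j + k%:~R * m j.+1); [exists j, k|].
Qed.
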